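(* Suppose $p_1,\ldots,p_n$ are conditionally valid (A1) and mutually independent (A2). Then the directional closed testing bounds $$\ell_\alpha^+(\mathcal I)=\ell_\alpha(\mathcal I\cap\mathcal S^-),\qquad \ell_\alpha^-(\mathcal I)=\ell_\alpha(\mathcal I\cap\mathcal S^+),\qquad \mathcal I\subseteq[n],$$ satisfy, for every $\theta\in\mathbb{R}^n$, $$\mathbb{P}_\theta\Big(n^+(\mathcal I)\ge\ell_\alpha^+(\mathcal I)\ \text{and}\ n^-(\mathcal I)\ge\ell_\alpha^-(\mathcal I)\ \text{for all }\mathcal I\subseteq[n]\ \Big|\ \mathcal S\Big)\ge 1-\alpha .$$
   Context: Setting. $[n]=\{1,\ldots,n\}$, $\alpha\in(0,1)$. $\{\mathbb{P}_\theta:\theta\in\mathbb{R}^n\}$ is a family of probability laws for a random vector $(p_1,\ldots,p_n)\in[0,1]^n$; $q_i=1-p_i$. Here $p_i$ is the $p$-value for $H_i^-:\theta_i\le 0$ and $q_i$ the $p$-value for $H_i^+:\theta_i\ge 0$. For $\mathcal I\subseteq[n]$, $n^+(\mathcal I)=|\{i\in\mathcal I:\theta_i>0\}|$ and $n^-(\mathcal I)=|\{i\in\mathcal I:\theta_i<0\}|$. (A1) Conditional validity: for every $i$ and $x\in[0,1]$, $\mathbb{P}_\theta(2p_i\le x\mid p_i\le 1/2)\le x$ for all $\theta$ with $\theta_i\le 0$, and $\mathbb{P}_\theta(2q_i\le x\mid p_i>1/2)\le x$ for all $\theta$ with $\theta_i\ge 0$ (whenever the conditioning event has positive probability). (A2)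 Under every $\mathbb{P}_\theta$, $p_1,\ldots,p_n$ are mutually independent. Selection. $\mathcal S^-=\{i:p_i\le 1/2\}$, $\mathcal S^+=\{i:p_i>1/2\}$. The vector of signs $\mathcal S\in\{-1,1\}^n$ has $i$th coordinate $-1$ if $p_i\le 1/2$ and $+1$ if $p_i>1/2$. Statements conditional on $\mathcal S$ mean: conditional on $\mathcal S=s$ for every $s$ of positive probability. Combining function. $f$ is a family of measurable functions $f:[0,1]^d\to[0,1]$, $d\ge 1$, which is valid for independent $p$-values: if $x_1,\ldots,x_d$ are independent with $\mathbb{P}(x_i\le t)\le t$ for all $t\in[0,1]$, then $\mathbb{P}(f(x_1,\ldots,x_d)\le t)\le t$ for all $t\in[0,1]$. Convention: $f(\emptyset)=1$. Local tests. For $\mathcal I\subseteq[n]$, $\phi_{\mathcal I}=\mathbf 1\{f(\{2p_i,i\in\mathcal I\cap\mathcal S^-\}\cup\{2q_j,j\in\mathcal I\cap\mathcal S^+\})\le\alpha\}$ (values listed in increasing order of index), so $\phi_\emptyset=0$. Closed testing. $\bar\phi_{\mathcal I}=\min\{\phi_{\mathcal J}:\mathcal I\subseteq\mathcal J\subseteq[n]\}$, and $\ell_\alpha(\mathcal I)=\min\{|\mathcal I\setminus\mathcal J|:\mathcal J\subseteq\mathcal I,\ \bar\phi_{\mathcal J}=0\}$. *)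

(* Defs.v *)
From HB Require Import structures.
From mathcomp Require Import all_boot all_order all_algebra.
From mathcomp Require Import all_classical all_reals all_analysis.
From mathcomp Require Import measurable_realfun lra.

Set Implicit Arguments.
Unset Strict Implicit.
Unset Printing Implicit Defensive.

Import Order.TTheory GRing.Theory Num.Theory.

Local Open Scope classical_set_scope.
Local Open Scope ring_scope.

Section probability_notions.
Context (R : realType) (d : measure_display) (T : measurableType d).
Implicit Types (P : probability T R).

(* Meaningful only when P B > 0; every use below is guarded by that. *)
Definition cprob P (A B : set T) : R := fine (P (A `&` B)) / fine (P B).

Definition mutually_independent P (m : nat) (X : 'I_m -> {mfun T >-> R}) : Prop :=
  forall (J : {set 'I_m}) (B : 'I_m -> set R),
    (forall i, measurable (B i)) ->
    (P (\big[setI/setT]_(i in J) (X i @^-1` B i)) =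
     \prod_(i in J) P (X i @^-1` B i))%E.

Definition unit_valued (m : nat) (X : 'I_m -> {mfun T >-> R}) : Prop :=
  forall i w, 0 <= X i w <= 1.

End probability_notions.

Section combining_functions.
Context (R : realType).

Definition cube (k : nat) : set (k.-tuple R) :=
  [set t | forall i, 0 <= tnth t i <= 1].
Arguments cube : clear implicits.

(* Each f k stands for a function [0,1]^k -> [0,1]: nothing is assumed
   about its values outside the cube. *)
Definition cube_measurable (f : forall k : nat, k.-tuple R -> R) : Prop :=
  forall k, (0 < k)%N ->
    measurable_fun (cube k) (f k) /\ (forall t, cube k t -> 0 <= f k t <= 1).

Definition valid_for_independent (f : forall k : nat, k.-tuple R -> R) : Prop :=
  forall k, (0 < k)%N ->
  forall (d : measure_display) (T : measurableType d) (Q : probability T R)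
    (x : 'I_k -> {mfun T >-> R}),
    unit_valued x ->
    mutually_independent Q x ->
    (forall i t, 0 <= t <= 1 -> (Q [set w | (x i w <= t)%R] <= t%:E)%E) ->
    forall t, 0 <= t <= 1 ->
      (Q [set w | (f k [tuple x i w | i < k] <= t)%R] <= t%:E)%E.

Record combining_function (f : forall k : nat, k.-tuple R -> R) : Prop :=
  CombiningFunction {
    combining_cube : cube_measurable f;
    combining_valid : valid_for_independent f;
    combining_nil : f 0%N [tuple] = 1 }.

End combining_functions.
Arguments cube : clear implicits.

Section model.
Context (R : realType) (d : measure_display) (T : measurableType d) (n : nat).
Implicit Types (P : 'rV[R]_n -> probability T R) (p : 'I_n -> {mfun T >-> R})
  (theta : 'rV[R]_n) (I : {set 'I_n}).

Definition conditionally_valid P p : Prop :=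
  forall (i : 'I_n) (x : R), 0 <= x <= 1 -> forall theta,
    (theta ord0 i <= 0 -> (0 < P theta [set w | (p i w <= 2^-1)%R])%E ->
       cprob (P theta) [set w | 2 * p i w <= x] [set w | p i w <= 2^-1] <= x)
    /\
    (0 <= theta ord0 i -> (0 < P theta [set w | (2^-1 < p i w)%R])%E ->
       cprob (P theta) [set w | 2 * (1 - p i w) <= x] [set w | 2^-1 < p i w]
         <= x).

Definition n_plus theta I : nat := #|[set i in I | 0 < theta ord0 i]|.
Definition n_minus theta I : nat := #|[set i in I | theta ord0 i < 0]|.

Definition S_minus p (w : T) : {set 'I_n} := [set i | p i w <= 2^-1]%SET.
Definition S_plus p (w : T) : {set 'I_n} := [set i | 2^-1 < p i w]%SET.

Definition signs p (w : T) : 'rV[int]_n :=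
  \row_i (if p i w <= 2^-1 then - 1 else 1).

(* The p-value of the direction picked by the data, adjusted for selection. *)
Definition selected_pvalue p (w : T) (i : 'I_n) : R :=
  if p i w <= 2^-1 then 2 * p i w else 2 * (1 - p i w).

(* S_minus and S_plus partition the indices and enum lists I in increasing
   order, so the tuple below is {2 p_i, i in I :&: S_minus} together with
   {2 q_j, j in I :&: S_plus}, listed by increasing index. *)
Definition local_test (f : forall k : nat, k.-tuple R -> R) (alpha : R) p
    (w : T) I : nat :=
  nat_of_bool
    (f #|I| [tuple of [seq selected_pvalue p w i | i <- enum I]] <= alpha)%R.

End model.

Section closed_testing.
Context (n : nat).
Implicit Types (phi : {set 'I_n} -> nat) (I : {set 'I_n}).

(* The minimum ranges over a nonempty family (it contains I), and a test takes
   its values in {0, 1}, so the default value 1 does not affect it. *)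
Definition closed_test phi I : nat :=
  \big[minn/1%N]_(J : {set 'I_n} | I \subset J) phi J.

(* #|I| bounds every term from above, so it is a harmless default value: when
   phi set0 = 0, J = set0 is admissible and the minimum is over a nonempty
   family. *)
Definition ell phi I : nat :=
  \big[minn/#|I|]_(J : {set 'I_n} | (J \subset I) && (closed_test phi J == 0%N))
    #|I :\: J|.

End closed_testing.

Section directional_bounds.
Context (R : realType) (d : measure_display) (T : measurableType d) (n : nat).
Context (f : forall k : nat, k.-tuple R -> R) (alpha : R)
  (p : 'I_n -> {mfun T >-> R}).
Implicit Types (theta : 'rV[R]_n) (I : {set 'I_n}).

Definition ell_plus (w : T) I : nat :=
  ell (local_test f alpha p w) (I :&: S_minus p w).

Definition ell_minus (w : T) I : nat :=
  ell (local_test f alpha p w) (I :&: S_plus p w).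

Definition coverage theta : set T :=
  [set w | forall I : {set 'I_n},
     (ell_plus w I <= n_plus theta I)%N /\ (ell_minus w I <= n_minus theta I)%N].

End directional_bounds.

(* The coverage event is measurable, so its probability is well defined. *)
Section coverage_measurable.
Context (R : realType) (d : measure_display) (T : measurableType d) (n : nat).
Context (f : forall k : nat, k.-tuple R -> R) (alpha : R)
  (p : 'I_n -> {mfun T >-> R}).
Arguments f : clear implicits.

Lemma closed_test_ext (phi psi : {set 'I_n} -> nat) :
  phi =1 psi -> closed_test phi =1 closed_test psi.
Proof. by move=> e I; apply: eq_bigr => J _; rewrite e. Qed.

Lemma ell_ext (phi psi : {set 'I_n} -> nat) :
  phi =1 psi -> ell phi =1 ell psi.
Proof. by move=> e I; apply: eq_bigl => J; rewrite (closed_test_ext e). Qed.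

Lemma measurable_le_half (i : 'I_n) :
  measurable_fun [set: T] (fun w => p i w <= 2^-1).
Proof. exact: measurable_fun_ler. Qed.

Lemma measurable_selected_pvalue (i : 'I_n) :
  measurable_fun [set: T] (fun w => selected_pvalue p w i).
Proof.
apply: measurable_fun_ifT.
- exact: measurable_le_half.
- by apply: measurable_funM.
- by apply: measurable_funM => //; apply: measurable_funB.
Qed.

Lemma selected_pvalue_unit w (i : 'I_n) :
  unit_valued p -> 0 <= selected_pvalue p w i <= 1.
Proof.
move=> /(_ i w) /andP[]; rewrite /selected_pvalue.
by move: (p i w) => x x0 x1; case: (leP x 2^-1) => h;
  apply/andP; split; lra.
Qed.

Lemma measurable_local_test (I : {set 'I_n}) :
  unit_valued p -> cube_measurable f ->
  measurable_fun [set: T] (fun w => f #|I|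
    [tuple of [seq selected_pvalue p w i | i <- enum I]] <= alpha).
Proof.
move=> p01 fm; apply: measurable_fun_ler => //.
set g := fun w => [tuple of [seq selected_pvalue p w i | i <- enum I]].
have mg : measurable_fun [set: T] g.
  apply/measurable_fun_tnthP => j.
  rewrite (_ : _ \o _ = fun w => selected_pvalue p w (tnth (enum_tuple I) j));
    first exact: measurable_selected_pvalue.
  by apply/funext => w /=; rewrite tnth_map.
have gc : [set g w | w in [set: T]] `<=` cube R #|I|.
  by move=> _ [w _ <-] j; rewrite tnth_map; exact: selected_pvalue_unit.
have mc k : measurable (cube R k).
  rewrite (_ : cube R k = \big[setI/setT]_(j < k)
      ((fun t => tnth t j) @^-1` [set` `[0, 1]])).
    apply: bigsetI_measurable => j _; rewrite -[X in measurable X]setTI.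
    exact: measurable_tnth.
  rewrite -bigcap_seq; apply/seteqP; split=> t /= h j.
    by move=> _; rewrite /= in_itv /=; exact: h.
  by have := h j (mem_index_enum j); rewrite /= in_itv.
have [I0|I0] := posnP #|I|; last first.
  by have [mf _] := fm _ I0; exact: (measurable_comp (mc _) gc mf mg).
rewrite (_ : (fun w => _) = cst (f #|I| (nseq_tuple #|I| 0))) //.
apply/funext => w /=; congr (f _ _); apply: eq_from_tnth => -[j jI].
by exfalso; rewrite I0 in jI.
Qed.

Lemma measurable_finite_valued (F : finType) (g : T -> F) (Q : set F) :
  (forall v, measurable [set w | g w = v]) -> measurable [set w | Q (g w)].
Proof.
move=> mg; rewrite (_ : [set w | _] = \bigcup_(v in Q) [set w | g w = v]).
  by apply: fin_bigcup_measurable => // ; exact: finite_finset.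
apply/seteqP; split=> w /=; first by move=> Qw; exists (g w).
by move=> [v Qv /= ->].
Qed.

Lemma measurable_bool_family (F : finType) (b : T -> F -> bool) :
  (forall i, measurable_fun [set: T] (b^~ i)) ->
  forall v : {ffun F -> bool}, measurable [set w | [ffun i => b w i] = v].
Proof.
move=> mb v; rewrite (_ : [set w | _] = \big[setI/setT]_i (b^~ i @^-1` [set v i])).
  apply: bigsetI_measurable => i _; rewrite -[X in measurable X]setTI.
  exact: mb.
rewrite -bigcap_seq; apply/seteqP; split=> w /=.
  by move=> h i _ /=; rewrite -h ffunE.
by move=> h; apply/ffunP => i; rewrite ffunE; apply: h; rewrite /= mem_index_enum.
Qed.

Lemma measurable_coverage theta :
  unit_valued p -> cube_measurable f -> measurable (coverage f alpha p theta).
Proof.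
move=> p01 fm.
pose b w (x : {set 'I_n} + 'I_n) : bool := match x with
  | inl J => f #|J| [tuple of [seq selected_pvalue p w i | i <- enum J]] <= alpha
  | inr i => p i w <= 2^-1 end.
pose phi (v : {ffun {set 'I_n} + 'I_n -> bool}) (I : {set 'I_n}) :=
  nat_of_bool (v (inl I)).
pose Sm (v : {ffun {set 'I_n} + 'I_n -> bool}) := [set i | v (inr i)]%SET.
pose Q : set {ffun {set 'I_n} + 'I_n -> bool} := [set v | forall I : {set 'I_n},
  (ell (phi v) (I :&: Sm v) <= n_plus theta I)%N /\
  (ell (phi v) (I :&: ~: Sm v) <= n_minus theta I)%N].
rewrite (_ : coverage _ _ _ _ = [set w | Q [ffun x => b w x]]).
  apply: measurable_finite_valued; apply: measurable_bool_family => x.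
  case: x => [J|i] /=; first exact: measurable_local_test.
  exact: measurable_le_half.
have phiE w : local_test f alpha p w =1 phi [ffun x => b w x].
  by move=> I; rewrite /phi ffunE.
have SmE w : S_minus p w = Sm [ffun x => b w x].
  by apply/setP => i; rewrite !inE ffunE.
have SpE w : S_plus p w = (~: Sm [ffun x => b w x])%SET.
  by apply/setP => i; rewrite !inE ffunE ltNge.
apply/seteqP; split=> w /= h I; have := h I;
  by rewrite /ell_plus /ell_minus !(ell_ext (phiE w)) SmE SpE.
Qed.

End coverage_measurable.

(* Main.v *)
Require Import Defs.
From HB Require Import structures.
From mathcomp Require Import all_boot all_order all_algebra.
From mathcomp Require Import all_classical all_reals all_analysis.
From mathcomp Require Import measurable_realfun lra.

Set Implicit Arguments.
Unset Strict Implicit.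
Unset Printing Implicit Defensive.

Import Order.TTheory GRing.Theory Num.Theory.

Local Open Scope classical_set_scope.
Local Open Scope ring_scope.

(** Fix theta and a sign vector s, and let N be the set of indices whose
    direction s_i is false, i.e. s_i = -1 with theta_i <= 0, or s_i = 1 with
    theta_i >= 0. If the single local test of N does not reject, then closed
    testing accepts every subset of N; since the selected null indices of I lie
    in N, both directional bounds hold for all I at once. Conditioning
    independent variables on a product event keeps them independent and
    conditions each of them on its own factor, so given the signs the folded
    p-values of N are independent and, by conditional validity, super-uniform:
    the local test of N rejects with conditional probability at most alpha. *)

(** * Combinatorics of closed testing *)

Lemma bigminn_le_seq (I : eqType) (r : seq I) (P : pred I) (F : I -> nat)
    (x : nat) (i : I) :
  i \in r -> P i -> (\big[minn/x]_(j <- r | P j) F j <= F i)%N.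
Proof.
elim: r => // a r IH; rewrite inE big_cons => /orP[/eqP <-|ir] Pi.
  by rewrite Pi geq_minl.
by case: ifP => _; rewrite ?geq_min IH ?orbT.
Qed.

Section closed_testing_bounds.
Context (n : nat) (phi : {set 'I_n} -> nat).
Implicit Types (I J N : {set 'I_n}).

Lemma closed_test_eq0 J N : J \subset N -> phi N = 0%N -> closed_test phi J = 0%N.
Proof.
move=> JN phi0; apply/eqP; rewrite -leqn0 -phi0.
by apply: bigminn_le_seq; rewrite ?mem_index_enum.
Qed.

(** [I :&: N] is admissible in the minimum: as a subset of the accepted set [N], it is accepted by
    closed testing. *)
Lemma ell_le_setD I N : phi N = 0%N -> (ell phi I <= #|I :\: N|)%N.
Proof.
move=> phi0; have -> : I :\: N = I :\: (I :&: N).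
  by rewrite finset.setDIr finset.setDv finset.set0U.
apply: (@bigminn_le_seq _ _ _ (fun J => #|I :\: J|)).
  by rewrite mem_index_enum.
by rewrite subsetIl (@closed_test_eq0 _ N) ?subsetIr.
Qed.

End closed_testing_bounds.

Lemma bigsetI_inP (T : Type) (I : finType) (J : {set I}) (F : I -> set T) w :
  (\big[setI/setT]_(i in J) F i) w <-> forall i, i \in J -> F i w.
Proof.
rewrite -bigcap_seq_cond; split=> [h i iJ|h i /= /andP[_]]; last exact: h.
by apply: h; rewrite /= mem_index_enum iJ.
Qed.

(** * The conditional law given an event *)

Section conditioning.
Context (R : realType) (d : measure_display) (T : measurableType d).
Context (P : probability T R) (D : set T) (mD : measurable D).

(** [mnormalize] falls back on [P] when [D] is null, so this is a probability without any positivity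
    assumption. *)
Definition conditional : probability T R := mnormalize (mrestr P mD) P.

Hypothesis PD0 : (0 < P D)%E.

Lemma conditionalE A : measurable A -> conditional A = (cprob P A D)%:E.
Proof.
move=> mA; have PDT : mrestr P mD setT = P D by congr (P _); exact: setTI.
rewrite /conditional /= /mnormalize /= PDT.
rewrite gt_eqF//= ifF; last first.
  by rewrite lt_eqF// ltey_eq fin_num_measure.
rewrite /cprob EFinM fineK// fin_num_measure//.
exact: measurableI.
Qed.

End conditioning.

(** * Independence under reindexing and under conditioning on a product event *)

Section independence.
Context (R : realType) (d : measure_display) (T : measurableType d).
Context (P : probability T R) (m : nat) (X : 'I_m -> {mfun T >-> R}).
Hypothesis indepX : mutually_independent P X.

(** An event on [Y j] is an event on [X (e j)], and injectivity sends distinct [j] to distinct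
    coordinates, so independence of [X] applies to the image of [J]. *)
Lemma mutually_independent_comp (k : nat) (e : 'I_k -> 'I_m) (h : R -> R)
    (Y : 'I_k -> {mfun T >-> R}) :
  injective e -> measurable_fun setT h -> (forall j w, Y j w = h (X (e j) w)) ->
  mutually_independent P Y.
Proof.
move=> e_inj mh YE J B mB.
(* [C] transports the family [B] along [e]; coordinates outside the image of [e] are left
   unconstrained. *)
pose C i := if [pick j | e j == i] is Some j then h @^-1` B j else setT.
have mC i : measurable (C i).
  rewrite /C; case: pickP => // j _; rewrite -[X in measurable X]setTI.
  exact: mh.
have CE j : C (e j) = h @^-1` B j.
  by rewrite /C; case: pickP => [i /eqP/e_inj ->//|/(_ j)]; rewrite eqxx.
have YC j : Y j @^-1` B j = X (e j) @^-1` C (e j).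
  by rewrite CE; apply/seteqP; split=> w /=; rewrite YE.
have := indepX [set e j | j in J]%SET mC.
rewrite !big_imset /=; try by move=> i j _ _; exact: e_inj.
by under [in X in _ -> X]eq_bigr do rewrite YC;
  under [in X in _ -> _ = X]eq_bigr do rewrite YC.
Qed.

Context (H : 'I_m -> set R).
Hypothesis mH : forall i, measurable (H i).
Let D := \big[setI/setT]_(i in [set: 'I_m]%SET) (X i @^-1` H i).

Lemma measurable_bigsetI_preimage : measurable D.
Proof. by apply: bigsetI_measurable => i _; exact: measurable_funPTI. Qed.

Hypothesis PD0 : (0 < P D)%E.

Let fineP A : measurable A -> P A = (fine (P A))%:E.
Proof. by move=> mA; rewrite fineK// fin_num_measure. Qed.

Let DE : P D = (\prod_(i in [set: 'I_m]%SET) fine (P (X i @^-1` H i)))%:E.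
Proof.
rewrite indepX// -prodEFin; apply: eq_bigr => i _; apply: fineP.
exact: measurable_funPTI.
Qed.

Lemma fine_preimage_neq0 i : fine (P (X i @^-1` H i)) != 0.
Proof.
apply: contraTneq PD0 => h0.
by rewrite DE (bigD1 i) ?finset.in_setT//= h0 mul0r ltxx.
Qed.

(** Intersecting with [D] keeps a product event. Numerator and denominator both factor over all
    coordinates, and the factors outside [J] cancel because none of them is zero. *)
Lemma cprob_bigsetI (J : {set 'I_m}) (B : 'I_m -> set R) :
  (forall i, measurable (B i)) ->
  cprob P (\big[setI/setT]_(i in J) (X i @^-1` B i)) D =
  \prod_(i in J) cprob P (X i @^-1` B i) (X i @^-1` H i).
Proof.
move=> mB; pose C i := if i \in J then B i `&` H i else H i.
have mC i : measurable (C i).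
  by rewrite /C; case: ifP => // _; exact: measurableI.
rewrite /cprob.
have -> : \big[setI/setT]_(i in J) (X i @^-1` B i) `&` D =
    \big[setI/setT]_(i in [set: 'I_m]%SET) (X i @^-1` C i).
  apply/seteqP; split=> w.
    move=> [/bigsetI_inP hB /bigsetI_inP hD]; apply/bigsetI_inP => i iT.
    rewrite /= /C; case: ifPn => iJ; last exact: hD.
    by split; [exact: hB|exact: hD].
  move=> /bigsetI_inP hC; split; apply/bigsetI_inP => i iJ.
    by have := hC i (finset.in_setT i); rewrite /= /C iJ => -[].
  by have := hC i iJ; rewrite /= /C; case: ifP => // _ [].
have -> : P (\big[setI/setT]_(i in [set: 'I_m]%SET) (X i @^-1` C i)) =
    (\prod_(i in [set: 'I_m]%SET) fine (P (X i @^-1` C i)))%:E.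
  rewrite indepX// -prodEFin; apply: eq_bigr => i _; apply: fineP.
  exact: measurable_funPTI.
rewrite DE /= -prodf_div [RHS]big_mkcond/=.
apply: eq_big => i; first by rewrite finset.in_setT.
move=> _; rewrite /C; case: ifP => // _.
by rewrite divff// fine_preimage_neq0.
Qed.

Lemma cprob_preimage i (B : set R) : measurable B ->
  cprob P (X i @^-1` B) D = cprob P (X i @^-1` B) (X i @^-1` H i).
Proof.
by move=> mB; have := @cprob_bigsetI [set i]%SET (fun=> B) (fun=> mB);
  rewrite !big_set1.
Qed.

Lemma mutually_independent_conditional (mD : measurable D) :
  mutually_independent (conditional P mD) X.
Proof.
move=> J B mB; rewrite conditionalE//; last first.
  by apply: bigsetI_measurable => i _; exact: measurable_funPTI.
rewrite cprob_bigsetI// -prodEFin; apply: eq_bigr => i _.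
by rewrite conditionalE ?cprob_preimage//; exact: measurable_funPTI.
Qed.

End independence.

(** * Sign selection and folded p-values *)

Section selection.
Context (R : realType) (d : measure_display) (T : measurableType d) (n : nat).
Context (f : forall k : nat, k.-tuple R -> R) (alpha : R)
  (p : 'I_n -> {mfun T >-> R}).
Implicit Types (theta : 'rV[R]_n).
Arguments f : clear implicits.

(** [b i] encodes the sign: true for -1, false for 1. Taking [b] as a parameter lets the set be
    frozen while the sample point varies. *)
Definition null_directions (b : 'I_n -> bool) theta : {set 'I_n} :=
  [set i | if b i then theta ord0 i <= 0 else 0 <= theta ord0 i]%SET.

(** A selected index outside the null set has its direction right: removing that set from
    [I :&: S_minus p w] leaves only positive parameters, and from [I :&: S_plus p w] only negative
    ones. *)
Lemma coverage_null_directions theta (w : T) :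
  local_test f alpha p w (null_directions (fun i => p i w <= 2^-1) theta) = 0%N ->
  coverage f alpha p theta w.
Proof.
move=> phi0 I; split; apply: leq_trans (ell_le_setD _ phi0) _;
  apply: subset_leq_card; apply/fintype.subsetP => i; rewrite !inE.
  by case: ifP; rewrite -ltNge => + /andP[+ /andP[->]]; rewrite ?andbF.
by case: leP; rewrite -ltNge => + /andP[+ /andP[->]]; rewrite ?andbF.
Qed.

(** Shows [selected_pvalue] as one fixed function of [p i], through which independence is carried
    over. *)
Definition folded_pvalue (x : R) : R := if x <= 2^-1 then 2 * x else 2 * (1 - x).

Lemma measurable_folded_pvalue : measurable_fun setT folded_pvalue.
Proof.
apply: measurable_fun_ifT.
- exact: measurable_fun_ler.
- exact: measurable_funM.
- by apply: measurable_funM => //; exact: measurable_funB.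
Qed.

Definition selected_mfun (i : 'I_n) : {mfun T >-> R} :=
  mfun_Sub (mem_set (measurable_selected_pvalue p i)).

Lemma signs_preimage (w0 : T) :
  [set w | signs p w = signs p w0] =
  \big[setI/setT]_(i in [set: 'I_n]%SET)
    (p i @^-1` [set x | (x <= 2^-1) = (p i w0 <= 2^-1)]).
Proof.
apply/seteqP; split=> w.
  move=> /= /rowP sw; apply/bigsetI_inP => i _ /=.
  by have := sw i; rewrite !mxE; do 2 case: ifP.
move=> /bigsetI_inP sw; apply/rowP => i; rewrite !mxE.
by have /= -> := sw i (finset.in_setT i).
Qed.

Lemma measurable_same_side (c : bool) : measurable [set x : R | (x <= 2^-1) = c].
Proof.
have mle : measurable_fun setT (fun x : R => x <= 2^-1).
  exact: measurable_fun_ler.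
by have := mle measurableT [set c] I; rewrite setTI.
Qed.

(** The equation [k = 0] is a hypothesis because the arity [#|N|] is zero only propositionally. *)
Lemma combining_function0 (k : nat) (t : k.-tuple R) :
  combining_function f -> k = 0%N -> f k t = 1.
Proof. by move=> [_ _ f0] k0; subst k; rewrite (tuple0 t). Qed.

(** On the given side of 1/2 the selected p-value is [2 * p i w] or [2 * (1 - p i w)], so this is
    one of the two halves of (A1). *)
Lemma cprob_selected_pvalue (P : 'rV[R]_n -> probability T R) theta
    (b : 'I_n -> bool) (i : 'I_n) (x : R) :
  conditionally_valid P p -> i \in null_directions b theta -> 0 <= x <= 1 ->
  fine (P theta (p i @^-1` [set y | (y <= 2^-1) = b i])) != 0 ->
  cprob (P theta) [set w | selected_pvalue p w i <= x]
    (p i @^-1` [set y | (y <= 2^-1) = b i]) <= x.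
Proof.
move=> A1 + x01; have := A1 i x x01 theta; rewrite inE.
have gt0 (A : set T) : fine (P theta A) != 0 -> (0 < P theta A)%E.
  move=> A0; rewrite lt_neqAle measure_ge0 andbT.
  by apply: contraNneq A0 => <-.
case: (b i) => -[] => [A1m _|_ A1p] hth /gt0.
- have -> : p i @^-1` [set y | (y <= 2^-1) = true] = [set w | p i w <= 2^-1] by [].
  move=> /(A1m hth); rewrite /cprob.
  congr (fine (P theta _) / _ <= _).
  by apply/seteqP; split=> w /= []; rewrite /selected_pvalue => + h; rewrite h.
- have -> : p i @^-1` [set y | (y <= 2^-1) = false] = [set w | 2^-1 < p i w].
    by apply/seteqP; split=> w /=; rewrite ltNge; [move=> /negbT|move=> /negbTE].
  move=> /(A1p hth); rewrite /cprob.
  congr (fine (P theta _) / _ <= _).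
  by apply/seteqP; split=> w /= [];
    rewrite /selected_pvalue => + h; rewrite (lt_geF h).
Qed.

(** [N] is computed from [w0], hence not random, and validity of [f] applies under the conditional
    law. *)
Lemma cprob_local_test (P : 'rV[R]_n -> probability T R) theta (w0 : T)
    (N := null_directions (fun i => p i w0 <= 2^-1) theta) :
  0 < alpha < 1 -> unit_valued p -> combining_function f ->
  conditionally_valid P p -> mutually_independent (P theta) p ->
  (0 < P theta [set w | signs p w = signs p w0])%E ->
  cprob (P theta) [set w | f #|N|
      [tuple of [seq selected_pvalue p w i | i <- enum N]] <= alpha]
    [set w | signs p w = signs p w0] <= alpha.
Proof.
move=> alpha01 p01 fc A1 A2; rewrite signs_preimage => PD0.
have mH i := measurable_same_side (p i w0 <= 2^-1).
have mD := @measurable_bigsetI_preimage _ _ _ _ p _ mH.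
(* Validity covers positive arity only; for empty [N] the combined value is 1, above [alpha], and
   rejection is impossible. *)
have [N0|Npos] := posnP #|N|.
  rewrite (_ : [set w | _] = set0); last first.
    apply/seteqP; split=> w //=; rewrite combining_function0//.
    by case/andP: alpha01; lra.
  by rewrite /cprob set0I measure0 mul0r; case/andP: alpha01 => /ltW.
pose x (j : 'I_#|N|) := selected_mfun (enum_val j).
have xE w : [tuple of [seq selected_pvalue p w i | i <- enum N]] =
    [tuple x j w | j < #|N|].
  apply: eq_from_tnth => j; rewrite tnth_map tnth_mktuple /=.
  by rewrite (tnth_nth (enum_val j)) -enum_val_nth.
under eq_set do rewrite xE.
rewrite -lee_fin -(conditionalE mD PD0); last first.
  have := measurable_local_test alpha N p01 (combining_cube fc) measurableT
    (Y := [set true]) I.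
  by rewrite setTI; under eq_set do rewrite -xE.
apply: (combining_valid fc Npos (Q := conditional (P theta) mD) (x := x)) => //.
- by move=> j w; exact: selected_pvalue_unit.
- apply: (@mutually_independent_comp _ _ _ _ _ p _ _ enum_val folded_pvalue).
  + exact: mutually_independent_conditional.
  + exact: enum_val_inj.
  + exact: measurable_folded_pvalue.
  + by [].
- move=> j t t01.
  have xjE : [set w | x j w <= t] =
      p (enum_val j) @^-1` (folded_pvalue @^-1` [set y | y <= t]) by [].
  have mft : measurable (folded_pvalue @^-1` [set y | y <= t]).
    rewrite -[X in measurable X]setTI; apply: measurable_folded_pvalue => //.
    by rewrite -set_itvNyc; exact: measurable_itv.
  rewrite conditionalE//; last by rewrite xjE; exact: measurable_funPTI.
  rewrite lee_fin xjE cprob_preimage//.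
  apply: (@cprob_selected_pvalue P theta (fun i => p i w0 <= 2^-1)) => //.
    exact: enum_valP.
  exact: (fine_preimage_neq0 A2 mH PD0).
- by case/andP: alpha01 => /ltW -> /ltW ->.
Qed.

End selection.

Theorem mainTheorem2 (R : realType) (d : measure_display) (T : measurableType d)
  (n : nat) (P : 'rV[R]_n -> probability T R) (p : 'I_n -> {mfun T >-> R})
  (alpha : R) (f : forall k : nat, k.-tuple R -> R)
  (alpha01 : 0 < alpha < 1)
  (p01 : unit_valued p)
  (f_combining : combining_function f)
  (A1 : conditionally_valid P p)
  (A2 : forall theta : 'rV[R]_n, mutually_independent (P theta) p) :
  forall (theta : 'rV[R]_n) (s : 'rV[int]_n),
    (0 < P theta [set w | signs p w = s])%E ->
    1 - alpha <=
      cprob (P theta) (coverage f alpha p theta) [set w | signs p w = s].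
Proof.
move=> theta s PD0.
(* A sign vector of positive probability is attained, and its null set can be read off at such a
   point [w0]. *)
have [w0 Dw0] : exists w0, signs p w0 = s.
  apply: contrapT => nD; move: PD0; rewrite (_ : [set w | _] = set0) ?measure0 ?ltxx//.
  by apply/seteqP; split=> w //= sw; apply: nD; exists w.
subst s; have mD : measurable [set w | signs p w = signs p w0].
  rewrite signs_preimage; apply: measurable_bigsetI_preimage => i.
  exact: measurable_same_side.
have mcov := measurable_coverage alpha theta p01 (combining_cube f_combining).
have := cprob_local_test alpha01 p01 f_combining A1 (A2 theta) PD0.
set N := null_directions _ _; set bad := [set w | _] => bad_le.
have mbad : measurable bad.
  have := measurable_local_test alpha N p01 (combining_cube f_combining)
    measurableT (Y := [set true]) I.
  by rewrite setTI.
(* Given the signs, the null set at [w] is [N], so coverage can fail only if [N] is rejected. *)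
have nocov_bad : ~` coverage f alpha p theta `&` [set w | signs p w = signs p w0]
    `<=` bad `&` [set w | signs p w = signs p w0].
  move=> w [ncov sw]; split=> //; apply: contrapT => nbad; apply: ncov.
  apply: coverage_null_directions.
  rewrite (_ : null_directions _ _ = N).
    by rewrite /local_test; case: leP => //; move: nbad; rewrite /bad /=; case: leP.
  move: sw; rewrite signs_preimage => /bigsetI_inP sw.
  by apply/setP => i; rewrite !inE; have /= -> := sw i (finset.in_setT i).
suff: 1 - cprob (P theta) (coverage f alpha p theta) [set w | signs p w = signs p w0]
    <= alpha by lra.
(* The complement rule holds for the conditional law; back to ratios, the common denominator cancels
   and monotonicity remains. *)
apply: le_trans bad_le; rewrite -lee_fin EFinB -!(conditionalE mD PD0)//.
rewrite -probability_setC// !conditionalE//; last exact: measurableC.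
rewrite lee_fin /cprob ler_pM2r ?invr_gt0 ?fine_gt0 ?PD0 ?ltey_eq ?fin_num_measure//.
apply: fine_le; rewrite ?fin_num_measure//; try by apply: measurableI => //; exact: measurableC.
apply: le_measure; rewrite ?inE//; try by apply: measurableI => //; exact: measurableC.
Qed.
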